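(* Let $\mu,\nu,\lambda$ be partitions with $\mu$ nonempty. If the plethysm coefficient $a^\lambda_{\mu[\nu]}$ is nonzero, then $[\nu]\subseteq[\lambda]$, i.e. $\nu_i\le\lambda_i$ for all $i$.
   Context: $a^\lambda_{\mu[\nu]}=\langle s_\lambda,\ s_\mu\circ s_\nu\rangle$ is the coefficient of $s_\lambda$ in the Schur expansion of the plethysm $s_\mu\circ s_\nu$. For a partition $\lambda$, its diagram is $[\lambda]=\{(j,i)\in\mathbb{N}_0^2:0\le j<\lambda_{i+1}\}$. *)

(* Defs.v *)
From mathcomp Require Import all_boot all_order all_algebra.
From mathcomp Require Export mpoly.
Set Implicit Arguments. Unset Strict Implicit. Unset Printing Implicit Defensive.
Import GRing.Theory.

Definition is_part (la : seq nat) : bool :=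
  sorted geq la && (0 \notin la).

Fixpoint parts_aux (fuel n k : nat) : seq (seq nat) :=
  if n == 0 then [:: [::]] else
  match fuel with
  | 0 => [::]
  | fuel'.+1 =>
      flatten [seq [seq p :: l | l <- parts_aux fuel' (n - p) p]
              | p <- iota 1 (minn n k)]
  end.

Definition parts (n : nat) : seq (seq nat) := parts_aux n n n.

(* Fillings of the rectangle 'I_(size la) x 'I_(la_1) with entries in 'I_m
   (row index i, column index j); the diagram of la is the set of cells
   (i,j) with j < la_(i+1) (here nth 0 la i). *)
Definition tabT (la : seq nat) (m : nat) :=
  {ffun 'I_(size la) * 'I_(head 0 la) -> 'I_m}.

(* Semistandard Young tableau of shape la with entries in {0,..,m-1}:
   cells outside the diagram are normalised to 0, rows weakly increase,
   columns strictly increase. *)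
Definition ssyt (la : seq nat) (m : nat) (t : tabT la m) : bool :=
  [&& [forall i : 'I_(size la), forall j : 'I_(head 0 la),
         (nth 0 la i <= j) ==> (val (t (i, j)) == 0)],
      [forall i : 'I_(size la), forall j1 : 'I_(head 0 la),
        forall j2 : 'I_(head 0 la),
         ((j1 < j2) && (j2 < nth 0 la i)) ==> (t (i, j1) <= t (i, j2))] &
      [forall i1 : 'I_(size la), forall i2 : 'I_(size la),
        forall j : 'I_(head 0 la),
         ((i1 < i2) && (j < nth 0 la i2)) ==> (t (i1, j) < t (i2, j))]].

Definition tab_weight (R : comPzRingType) (la : seq nat) (m : nat)
    (y : 'I_m -> R) (t : tabT la m) : R :=
  \prod_(ij : 'I_(size la) * 'I_(head 0 la) | ij.2 < nth 0 la ij.1) y (t ij).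

Definition schur_eval (R : comPzRingType) (m : nat) (la : seq nat)
    (y : 'I_m -> R) : R :=
  \sum_(t : tabT la m | ssyt t) tab_weight y t.

Definition schur (n : nat) (la : seq nat) : {mpoly int[n]} :=
  schur_eval la (fun i : 'I_n => 'X_i).

Definition schur_monomials (n : nat) (nu : seq nat) : seq {mpoly int[n]} :=
  [seq tab_weight (fun i : 'I_n => 'X_i) t
  | t <- enum (tabT nu n) & ssyt t].

(* Plethysm s_mu o s_nu in n variables: s_mu evaluated at the monomials
   of s_nu (s_nu has nonnegative integer monomial coefficients). *)
Definition plethysm (n : nat) (mu nu : seq nat) : {mpoly int[n]} :=
  let ms := schur_monomials n nu in
  schur_eval mu (fun k : 'I_(size ms) => nth 0%R ms k).

(* Main.v *)
Require Import Defs.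
From mathcomp Require Import all_boot all_order all_algebra.
From mathcomp Require Import mpoly.
From mathcomp Require Import all_field.
From mathcomp Require Import zify ring.

(** Suppose la_(p+1) <= q < nu_(p+1). Specialise symmetric functions at the
    virtual alphabet x_0 + ... + x_(p-1) - z_0 - ... - z_(q-1). By Jacobi-Trudi
    and the branching rules for adding or removing one variable, the
    specialised s_ka vanishes as soon as ka contains the cell (p+1, q+1), while
    the specialisations of the other s_ka are linearly independent. Over an
    algebraically closed field the virtual alphabet agrees, on power sums of
    degree at most N, with an honest point u of N coordinates. The monomials of
    s_nu at u have r-th power sum s_nu(u^r), which is s_nu at the virtual
    alphabet x^r - z^r, hence 0; so all their complete symmetric functions of
    degree 1, ..., |mu| vanish, and s_mu o s_nu vanishes at u. Independence
    then kills the coefficient of s_la. *)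

Set Implicit Arguments.
Unset Strict Implicit.
Unset Printing Implicit Defensive.

Import Order.TTheory GRing.Theory Num.Theory.

(** * Virtual alphabets and Newton identities *)

Section Alphabets.
Local Open Scope ring_scope.

Definition hempty (R : nzRingType) (n : nat) : R := (n == 0%N)%:R.

(** On generating series in t, [hadd x] divides by 1 - x t and [hrem z] multiplies by 1 - z t, so
    [hneg z q] lists the coefficients of the product of the 1 - z_i t. *)
Fixpoint hadd (R : nzRingType) (x : R) (h : nat -> R) (n : nat) : R :=
  if n is n'.+1 then h n + x * hadd x h n' else h 0%N.

Definition hrem (R : nzRingType) (z : R) (h : nat -> R) (n : nat) : R :=
  if n is n'.+1 then h n - z * h n' else h 0%N.

Fixpoint hneg (R : nzRingType) (z : nat -> R) (q : nat) : nat -> R :=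
  if q is q'.+1 then hrem (z q') (hneg z q') else hempty R.

(* The complete symmetric functions of the virtual alphabet
   x_0 + ... + x_(p-1) - z_0 - ... - z_(q-1). *)
Fixpoint hsuper (R : nzRingType) (x z : nat -> R) (p q : nat) : nat -> R :=
  if p is p'.+1 then hadd (x p') (hsuper x z p' q) else hneg z q.

(* p k is the k-th power sum for k > 0; the value p 0 is irrelevant. *)
Definition newton_pair (R : nzRingType) (p h : nat -> R) : Prop :=
  h 0%N = 1 /\
  forall n, h n.+1 *+ n.+1 = \sum_(k < n.+1) p k.+1 * h (n - k)%N.

Lemma eq_newton_pair (R : nzRingType) (p p' h : nat -> R) :
  p =1 p' -> newton_pair p h -> newton_pair p' h.
Proof.
move=> eqp [h0 hS]; split=> // n; rewrite hS.
by apply: eq_bigr => k _; rewrite eqp.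
Qed.

Lemma newton_hempty (R : nzRingType) : newton_pair (fun=> 0) (hempty R).
Proof.
split=> // n; rewrite mul0rn big1 // => k _; exact: mul0r.
Qed.

(** The logarithmic derivative of the generating series gains that of 1/(1 - x t). On coefficients,
    each half of the sum reproduces itself one degree lower with a factor [x] ([Tn] and [Sn]), which
    drives an induction on the degree. *)
Lemma newton_hadd (R : comNzRingType) (x : R) p h :
  newton_pair p h -> newton_pair (fun k => p k + x ^+ k) (hadd x h).
Proof.
move=> [h0 hS]; split=> // n.
have Tn m : \sum_(k < m.+1) x ^+ k.+1 * hadd x h (m - k) =
            hadd x h m * x + x * (if m is m'.+1 then
              \sum_(k < m'.+1) x ^+ k.+1 * hadd x h (m' - k) else 0).
  rewrite big_ord_recl expr1 subn0 mulrC; congr (_ + _).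
  case: m => [|m]; first by rewrite big_ord0 mulr0.
  by rewrite big_distrr /=; apply: eq_bigr => k _; rewrite exprS mulrA subSS.
have Sn m : \sum_(k < m.+1) p k.+1 * hadd x h (m - k) =
            h m.+1 *+ m.+1 + x * (if m is m'.+1 then
              \sum_(k < m'.+1) p k.+1 * hadd x h (m' - k) else 0).
  rewrite hS; case: m => [|m].
    by rewrite !big_ord_recl !big_ord0 /= mulr0 !addr0.
  rewrite big_ord_recr [in RHS]big_ord_recr /= subnn addrAC; congr (_ + _).
  rewrite big_distrr -big_split /=; apply: eq_bigr => k _.
  rewrite subSn; last by rewrite -ltnS.
  by rewrite /= mulrDr; congr (_ + _); rewrite mulrCA.
under eq_bigr do rewrite mulrDl.
rewrite big_split /= Sn Tn; elim: n => [|n IHn] /=.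
  by rewrite !mulr0 !addr0 mulr1n [_ * x]mulrC.
rewrite Sn Tn addrACA -mulrDr -IHn /= mulrnDl -[(x * _) *+ _]mulrnAr.
by rewrite [in LHS]mulrS mulrDr addrA [_ * x]mulrC.
Qed.

(** The geometric series of ratio z t undoes the factor 1 - z t, so the sum against powers of [z]
    collapses to the single term [z * h m]. *)
Lemma newton_hrem (R : comNzRingType) (z : R) p h :
  newton_pair p h -> newton_pair (fun k => p k - z ^+ k) (hrem z h).
Proof.
move=> [h0 hS]; split=> // n.
have T m : \sum_(k < m.+1) z ^+ k.+1 * hrem z h (m - k) = z * h m.
  elim: m => [|m IHm]; first by rewrite big_ord_recl big_ord0 expr1 addr0.
  rewrite big_ord_recl; under eq_bigr => k _ do
    rewrite /= subSS exprS -mulrA.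
  by rewrite -big_distrr /= IHm; ring.
have S m : \sum_(k < m.+1) p k.+1 * hrem z h (m - k) =
           h m.+1 *+ m.+1 - z * (h m *+ m).
  rewrite hS; case: m => [|m].
    by rewrite !big_ord_recl !big_ord0 mulr0n mulr0 subr0.
  rewrite big_ord_recr [X in _ = X - _]big_ord_recr /= subnn hS addrAC.
  congr (_ + _).
  rewrite big_distrr -sumrB; apply: eq_bigr => k _.
  by rewrite subSn -1?ltnS //= mulrBr; congr (_ - _); rewrite mulrCA.
under eq_bigr do rewrite mulrBl.
rewrite sumrB T S /= mulrnBl -[(z * _) *+ _]mulrnAr.
by rewrite [h n *+ n.+1]mulrSr mulrDr opprD addrA.
Qed.

Definition psuper (R : nzRingType) (x z : nat -> R) (p q k : nat) : R :=
  \sum_(i < p) x i ^+ k - \sum_(i < q) z i ^+ k.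

Lemma newton_hsuper (R : comNzRingType) (x z : nat -> R) p q :
  newton_pair (psuper x z p q) (hsuper x z p q).
Proof.
elim: p => [|p IHp] /=.
  elim: q => [|q IHq] /=.
    by apply: eq_newton_pair (newton_hempty R) => k; rewrite /psuper !big_ord0 subr0.
  apply: eq_newton_pair (newton_hrem _ IHq) => k.
  by rewrite /psuper [in RHS]big_ord_recr /= opprD addrA.
apply: eq_newton_pair (newton_hadd _ IHp) => k.
by rewrite /psuper [in RHS]big_ord_recr /= addrAC.
Qed.

(** Newton's identities determine [h n.+1] from lower degrees once the factor n+1 is cancelled,
    which characteristic zero permits. *)
Lemma newton_inj_h (R : numDomainType) (p p' h h' : nat -> R) N :
  newton_pair p h -> newton_pair p' h' ->
  (forall k, 0 < k <= N -> p k = p' k)%N ->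
  forall n, (n <= N)%N -> h n = h' n.
Proof.
move=> [h0 hS] [h0' hS'] eqp n; have [m] := ubnP n.
elim: m n => // m IHm [|n] lenm lenN; first by rewrite h0 h0'.
apply: (@mulIf _ n.+1%:R); first by rewrite pnatr_eq0.
rewrite !mulr_natr hS hS'; apply: eq_bigr => -[k lt_kn] _ /=.
by rewrite eqp ?(leq_trans lt_kn) // IHm //; lia.
Qed.

(** The last summand of Newton's identity is [p k.+1 * h 0 = p k.+1], so the power sums can be
    solved for recursively. *)
Lemma newton_inj_p (R : comNzRingType) (p p' h h' : nat -> R) N :
  newton_pair p h -> newton_pair p' h' ->
  (forall n, n <= N -> h n = h' n)%N ->
  forall k, (0 < k <= N)%N -> p k = p' k.
Proof.
move=> [h0 hS] [h0' hS'] eqh k; have [m] := ubnP k.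
elim: m k => // m IHm [|k] // lenm lenN.
have := hS k; rewrite eqh // hS' !big_ord_recr /= subnn h0 h0' !mulr1.
rewrite (eq_bigr (fun i : 'I_k => p i.+1 * h (k - i)%N)) => [/addrI //|].
by move=> [i lt_ik] _ /=; rewrite -eqh ?IHm //; lia.
Qed.

Lemma hneg_gt (R : nzRingType) (z : nat -> R) q n : (q < n)%N -> hneg z q n = 0.
Proof.
elim: q n => [|q IHq] [|n] //= lt_qn.
by rewrite !IHq ?mulr0 ?subr0 // ltnW.
Qed.

(** Vieta's formula: both sides are (-1)^n e_n(z_0, ..., z_(q-1)). *)
Lemma hneg_prod_XsubC (R : comNzRingType) (z : nat -> R) q n : (n <= q)%N ->
  hneg z q n = (\prod_(i < q) ('X - (z i)%:P))`_(q - n).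
Proof.
elim: q n => [|q IHq] n; first by case: n => // _; rewrite big_ord0 coef1.
have top : (\prod_(i < q) ('X - (z i)%:P))`_q.+1 = 0.
  rewrite nth_default // -(big_mkord xpredT (fun i => 'X - (z i)%:P)).
  by rewrite size_prod_XsubC size_iota subn0.
rewrite big_ord_recr /= mulrBr coefB coefMX coefMC; case: n => [|n] len.
  by rewrite /= IHq // !subn0 /= top mul0r subr0.
rewrite subSS /= [X in z q * X]IHq // [z q * _]mulrC.
have [->|lt_nq] := eqVneq n q; first by rewrite subnn hneg_gt.
rewrite subn_eq0 leqNgt IHq; last by lia.
have -> : (n < q)%N by lia.
by rewrite subnS.
Qed.
End Alphabets.

(** * Jacobi-Trudi determinants and branching rules *)

Section JacobiTrudi.
Local Open Scope ring_scope.

Lemma big_ord_interval (T : Type) (idx : T) (op : Monoid.law idx) (F : nat -> T) a b K :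
  (b <= K)%N -> \big[op/idx]_(m < K | (a <= m < b)%N) F m = \big[op/idx]_(a <= m < b) F m.
Proof.
move=> lebK; rewrite (big_nat_widenl a 0) // (big_nat_widen 0 b K) // big_mkord.
by apply: eq_bigl => m.
Qed.

(* h_(a - c), where h_n = 0 for n < 0. *)
Definition hdiff (R : nzRingType) (h : nat -> R) (a c : nat) : R :=
  if (c <= a)%N then h (a - c)%N else 0.

Lemma hdiffSS (R : nzRingType) (h : nat -> R) a c :
  hdiff h a.+1 c.+1 = hdiff h a c.
Proof. by rewrite /hdiff ltnS subSS. Qed.

Definition jacobi_trudi (R : comNzRingType) (L : nat) (s : nat -> nat)
    (h : nat -> R) : R :=
  \det (\matrix_(i < L, j < L) hdiff h (s i + j) i).

(** Functions into ['I_K] form a finite type over which the branching rules can sum; [shape_of]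
    continues such a function by empty rows. *)
Definition shape_of (L K : nat) (f : {ffun 'I_L -> 'I_K}) (k : nat) : nat :=
  oapp (fun i => val (f i)) 0%N (insub k).

Lemma shape_ofE L K (f : {ffun 'I_L -> 'I_K}) (i : 'I_L) : shape_of f i = f i.
Proof. by rewrite /shape_of valK. Qed.

Lemma shape_of_geq L K (f : {ffun 'I_L -> 'I_K}) k :
  (L <= k)%N -> shape_of f k = 0%N.
Proof. by move=> leLk; rewrite /shape_of insubF // ltnNge leLk. Qed.

Lemma eq_jacobi_trudi (R : comNzRingType) L (s s' : nat -> nat) (h h' : nat -> R) :
  (forall i, (i < L)%N -> s i = s' i) ->
  (forall i j, (i < L)%N -> (j < L)%N -> h (s i + j - i)%N = h' (s i + j - i)%N) ->
  jacobi_trudi L s h = jacobi_trudi L s' h'.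
Proof.
move=> eqs eqh; congr (\det _); apply/matrixP => i j; rewrite !mxE /hdiff.
by rewrite -eqs // eqh.
Qed.

Lemma jacobi_trudi0 (R : comNzRingType) L s (h : nat -> R) : (0 < L)%N ->
  (forall j, (j < L)%N -> h (s 0%N + j)%N = 0) -> jacobi_trudi L s h = 0.
Proof.
case: L => // L _ h0; rewrite /jacobi_trudi (expand_det_row _ ord0) big1 // => j _.
by rewrite mxE /hdiff subn0 h0 // mul0r.
Qed.

Lemma jacobi_trudi_hempty (R : comNzRingType) L s :
  (forall i, (i < L)%N -> s i = 0%N) -> jacobi_trudi L s (hempty R) = 1.
Proof.
move=> s0; rewrite /jacobi_trudi -[RHS](det1 R L); congr (\det _).
apply/matrixP => i j; rewrite !mxE /hdiff /hempty s0 // add0n -val_eqE /= subn_eq0.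
by case: ltngtP.
Qed.

(** An empty last row of the shape gives the matrix row (0, ..., 0, 1), along which the determinant
    is expanded. *)
Lemma jacobi_trudi_extend (R : comNzRingType) L M s (h : nat -> R) :
  h 0%N = 1 -> (L <= M)%N -> (forall k, (L <= k)%N -> s k = 0%N) ->
  jacobi_trudi M s h = jacobi_trudi L s h.
Proof.
move=> h0 leLM s0; elim: M leLM => [|M IHM]; first by rewrite leqn0 => /eqP ->.
rewrite leq_eqVlt => /predU1P [-> //|]; rewrite ltnS => leLM.
rewrite -{}IHM // /jacobi_trudi (expand_det_row _ ord_max) big_ord_recr /=.
rewrite big1 ?add0r => [|j _].
  rewrite mxE /hdiff s0 // add0n leqnn subnn h0 mul1r /cofactor addnn -signr_odd.
  rewrite odd_double mul1r; congr (\det _); apply/matrixP => i j.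
  by rewrite !mxE !lift_max.
by rewrite mxE /hdiff s0 //= add0n leqNgt ltn_ord mul0r.
Qed.

(** The row operations are left multiplication by the unitriangular matrix [T]; [G L = 0] stands for
    the absent row below the last one. *)
Lemma det_row_reduce (R : comNzRingType) L (G : nat -> 'I_L -> R) (b : nat -> R) :
  (forall j, G L j = 0) ->
  \det (\matrix_(i < L, j < L) (G i j - b i * G i.+1 j)) =
  \det (\matrix_(i < L, j < L) G i j).
Proof.
move=> GL; pose T := \matrix_(i < L, k < L)
  ((i == k)%:R - b i * (k == i.+1 :> nat)%:R : R).
have -> : (\matrix_(i < L, j < L) (G i j - b i * G i.+1 j)) =
          T *m (\matrix_(i < L, j < L) G i j).
  apply/matrixP => i j; rewrite !mxE.
  under eq_bigr => k _ do rewrite !mxE mulrBl.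
  rewrite sumrB (bigD1 i) //= eqxx mul1r big1 ?addr0; last first.
    by move=> k /negPf nki; rewrite eq_sym nki mul0r.
  congr (_ - _); have [lt|ge] := ltnP i.+1 L.
    rewrite (bigD1 (Ordinal lt)) //= eqxx mulr1 big1 ?addr0 //.
    by move=> k /negPf; rewrite -val_eqE /= => ->; rewrite mulr0 mul0r.
  have -> : i.+1 = L by have := ltn_ord i; lia.
  rewrite GL mulr0 big1 // => k _.
  by rewrite ltn_eqF ?ltn_ord // mulr0 mul0r.
rewrite det_mulmx -[\det T]det_tr det_trig; last first.
  apply/is_trig_mxP => i j ltij; rewrite !mxE.
  have -> : (j == i) = false by rewrite -val_eqE /=; lia.
  have -> : (i == j.+1 :> nat) = false by lia.
  by rewrite mulr0 subr0.
rewrite big1 ?mul1r // => i _; rewrite !mxE eqxx.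
have -> : (i == i.+1 :> nat) = false by lia.
by rewrite mulr0 subr0.
Qed.

Lemma det_multilinear (R : comNzRingType) L K (a : 'I_L -> 'I_K -> R)
    (w : 'I_L -> 'I_K -> 'I_L -> R) :
  \det (\matrix_(i < L, j < L) \sum_m a i m * w i m j) =
  \sum_(f : {ffun 'I_L -> 'I_K})
    (\prod_i a i (f i)) * \det (\matrix_(i < L, j < L) w i (f i) j).
Proof.
rewrite /determinant.
under [RHS]eq_bigr => f _ do rewrite big_distrr /=.
rewrite exchange_big /=; apply: eq_bigr => s _.
under eq_bigr => i _ do rewrite mxE.
rewrite bigA_distr_bigA big_distrr /=; apply: eq_bigr => f _.
rewrite mulrCA big_split /=; congr (_ * (_ * _)).
by apply: eq_bigr => i _; rewrite mxE.
Qed.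

Lemma prod_if_expr (R : comNzRingType) L (x : R) (P : pred 'I_L) (d : 'I_L -> nat) :
  \prod_i (if P i then x ^+ d i else 0) =
  if [forall i, P i] then x ^+ (\sum_i d i) else 0.
Proof.
case: ifP => [/forallP allP|/negbT].
  by rewrite expr_sum; apply: eq_bigr => i _; rewrite allP.
rewrite negb_forall => /existsP [i /negPf nPi].
by rewrite (bigD1 i) //= nPi mul0r.
Qed.

Lemma big_nat_rev_ord (R : nmodType) (F : nat -> R) a b : (a <= b)%N ->
  \sum_(a <= m < b.+1) F m = \sum_(d < (b - a).+1) F (b - d)%N.
Proof.
move=> leab; rewrite big_nat_rev -[X in \big[_/_]_(X <= _ < _) _]add0n big_addn.
rewrite subSn // big_mkord; apply: eq_bigr => d _; congr (F _); lia.
Qed.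

Definition hstrip L K (s : nat -> nat) (f : {ffun 'I_L -> 'I_K}) :=
  [forall i : 'I_L, s i.+1 <= f i <= s i]%N.

Lemma hdiff_hadd (R : comNzRingType) (x : R) h a c k :
  hdiff (hadd x h) (a + k) c.+1 =
  \sum_(d < k) x ^+ d * hdiff h (a + k - d) c.+1
    + x ^+ k * hdiff (hadd x h) a c.+1.
Proof.
have step b : hdiff (hadd x h) b.+1 c.+1 =
              hdiff h b.+1 c.+1 + x * hdiff (hadd x h) b c.+1.
  rewrite /hdiff ltnS; have [lt|gt|->] := ltngtP c b.
  - by rewrite subSS subnS; case E: (b - c)%N => [|e] //=; lia.
  - by rewrite mulr0 addr0.
  - by rewrite subnn /= mulr0 addr0.
elim: k => [|k IHk]; first by rewrite addn0 big_ord0 add0r mul1r.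
rewrite addnS step IHk big_ord_recl /= mul1r subn0 -addrA; congr (_ + _).
rewrite mulrDr mulrA -exprS; congr (_ + _); rewrite big_distrr /=.
by apply: eq_bigr => d _; rewrite mulrA -exprS subSS.
Qed.

(** The indices in rows i and i+1 differ by s_i - s_(i+1) + 1. Subtracting that power of [x] times
    row i+1 from row i therefore cuts the expansion of [hadd] down to the lengths between s_(i+1)
    and s_i. Multilinearity then gives one determinant for each horizontal strip. *)
Lemma jacobi_trudi_hadd (R : comNzRingType) L K s (x : R) h :
  (forall i, s i.+1 <= s i)%N -> (s L = 0)%N -> (s 0 < K)%N ->
  jacobi_trudi L s (hadd x h) =
  \sum_(f : {ffun 'I_L -> 'I_K} | hstrip s f)
    x ^+ (\sum_(i < L) (s i - f i)) * jacobi_trudi L (shape_of f) h.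
Proof.
move=> sS sL sK.
have sltK i : (s i < K)%N by elim: i => // i; apply: leq_ltn_trans.
pose G i (j : 'I_L) := hdiff (hadd x h) (s i + j) i.
rewrite /jacobi_trudi.
rewrite -(@det_row_reduce _ _ G (fun i => x ^+ (s i - s i.+1).+1)); last first.
  by move=> j; rewrite /G sL add0n /hdiff leqNgt ltn_ord.
transitivity (\det (\matrix_(i < L, j < L) \sum_(m < K)
   (if (s i.+1 <= m <= s i)%N then x ^+ (s i - m) else 0) * hdiff h (m + j) i)).
  congr (\det _); apply/matrixP => i j; rewrite !mxE /G.
  have -> : hdiff (hadd x h) (s i + j) i =
            hdiff (hadd x h) ((s i.+1 + j) + (s i - s i.+1).+1) i.+1.
    have -> : (s i.+1 + j + (s i - s i.+1).+1 = (s i + j).+1)%N.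
      by have := sS i; lia.
    by rewrite hdiffSS.
  rewrite hdiff_hadd addrK; under eq_bigr => d _.
    have -> : (s i.+1 + j + (s i - s i.+1).+1 - d = (s i - d + j).+1)%N.
      by have := sS i; have := ltn_ord d; lia.
    rewrite hdiffSS; over.
  have -> : \sum_(m < K) (if (s i.+1 <= m <= s i)%N then x ^+ (s i - m) else 0)
              * hdiff h (m + j) i =
            \sum_(m < K | (s i.+1 <= m <= s i)%N) x ^+ (s i - m) * hdiff h (m + j) i.
    by rewrite [RHS]big_mkcond; apply: eq_bigr => m _; case: ifP; rewrite ?mul0r.
  rewrite (eq_bigl (fun m : 'I_K => s i.+1 <= m < (s i).+1)%N) //.
  rewrite (big_ord_interval _ (fun m => x ^+ (s i - m) * hdiff h (m + j) i)) //.
  rewrite big_nat_rev_ord //; apply: eq_bigr => d _; have := ltn_ord d; have := sS i => le1 le2.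
  by congr (_ ^+ _ * hdiff h (_ + j) i); lia.
rewrite det_multilinear [RHS]big_mkcond; apply: eq_bigr => f _.
rewrite prod_if_expr /hstrip; case: ifP; rewrite ?mul0r // => _.
congr (_ * \det _); apply/matrixP => i j; rewrite !mxE.
by rewrite shape_ofE.
Qed.

Lemma hdiff_hrem (R : nzRingType) (z : R) h a c :
  hdiff (hrem z h) a c = hdiff h a c - z * hdiff h a c.+1.
Proof.
rewrite /hdiff; have [lt|gt|->] := ltngtP c a; rewrite ?mulr0 ?subr0 //.
  by rewrite subnS; case E: (a - c)%N => [|e] //; lia.
by rewrite subnn.
Qed.

(** Unlike the interlacing condition in [hstrip], the row bounds alone do not force [f] to decrease,
    so this is demanded separately. *)
Definition vstrip L K (s : nat -> nat) (f : {ffun 'I_L -> 'I_K}) :=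
  [forall i : 'I_L, shape_of f i.+1 <= f i]%N
    && [forall i : 'I_L, f i <= s i <= (f i).+1]%N.

(** Every entry is a difference of two terms, so row i offers the choices s_i and s_i - 1;
    multilinearity sums over all choices, and those that are not partitions give determinants with
    two equal rows. *)
Lemma jacobi_trudi_hrem (R : comNzRingType) L K s (z : R) h :
  (forall i, s i.+1 <= s i)%N -> (s L = 0)%N -> (s 0 < K)%N ->
  jacobi_trudi L s (hrem z h) =
  \sum_(f : {ffun 'I_L -> 'I_K} | vstrip s f)
    (- z) ^+ (\sum_(i < L) (s i - f i)) * jacobi_trudi L (shape_of f) h.
Proof.
move=> sS sL sK.
have sltK i : (s i < K)%N by elim: i => // i; apply: leq_ltn_trans.
pose G i (j : 'I_L) := hdiff h (s i + j) i
  - (if s i is k.+1 then z * hdiff h (k + j) i else 0).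
have GL j : G L j = 0.
  by rewrite /G sL /hdiff add0n leqNgt ltn_ord subr0.
transitivity (\det (\matrix_(i < L, j < L) G i j)).
  (* No cell can leave an empty row: there the second term is [z] times the next row, itself empty,
     and a row operation cancels it. *)
  rewrite -(det_row_reduce (fun i => if s i == 0%N then z else 0) GL).
  congr (\det _); apply/matrixP => i j; rewrite !mxE /G.
  case: (s i) (sS i) => [|k] /=.
    by rewrite leqn0 => /eqP ->; rewrite !add0n !subr0 hdiff_hrem.
  by move=> _; rewrite mul0r subr0 hdiff_hrem addSn hdiffSS.
pose a i m : R := if (m <= s i <= m.+1)%N then (- z) ^+ (s i - m) else 0.
transitivity (\det (\matrix_(i < L, j < L)
    \sum_(m < K) a i m * hdiff h (m + j) i)).
  congr (\det _); apply/matrixP => i j; rewrite !mxE /G /a.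
  pose si : 'I_K := Ordinal (sltK i).
  rewrite (bigD1 si) //= leqnn leqnSn subnn mul1r.
  congr (_ + _); case E: (s i) => [|k] /=.
    rewrite oppr0 big1 // => m; rewrite -val_eqE /= => /negPf m0.
    by rewrite leqn0 -E m0 mul0r.
  have ltk : (k < K)%N by have := sltK i; lia.
  pose k' : 'I_K := Ordinal ltk.
  rewrite (bigD1 k') /= -?val_eqE /= ?E ?ltn_eqF //.
  rewrite leqnn leqnSn subSnn expr1 mulNr big1 ?addr0 // => m.
  rewrite -!val_eqE /= E => /andP [nk1 nk].
  by case: ifP; rewrite ?mul0r //; lia.
rewrite det_multilinear [RHS]big_mkcond; apply: eq_bigr => f _.
rewrite prod_if_expr /vstrip andbC; case: ifP; rewrite ?mul0r //= => /forallP near.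
case: ifP => [_|/negbT]; last first.
  rewrite negb_forall => /existsP [i]; rewrite -ltnNge => lt.
  have ltL : (i.+1 < L)%N.
    by rewrite ltnNge; apply/negP => ge; rewrite shape_of_geq in lt.
  (* An ascent of [f] within one cell of the decreasing [s] forces f_(i+1) = f_i + 1, and then rows
     i and i+1 of the matrix coincide. *)
  rewrite (determinant_alternate (i1 := i) (i2 := Ordinal ltL)) ?mulr0 //.
    by rewrite -val_eqE /= ltn_eqF.
  move=> j; rewrite !mxE /=.
  have := near (Ordinal ltL); have := near i; have := sS i; move: lt.
  rewrite -[i.+1]/(val (Ordinal ltL)) shape_ofE /= => lt le1 le2 le3.
  have -> : f (Ordinal ltL) = (f i).+1 :> nat.
    case/andP: le2 => _ le2; case/andP: le3 => le3 _.
    apply/eqP; rewrite eqn_leq lt andbT.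
    exact: leq_trans le3 (leq_trans le1 le2).
  by rewrite addSn hdiffSS.
congr (_ * \det _); apply/matrixP => i j; rewrite !mxE.
by rewrite shape_ofE.
Qed.
End JacobiTrudi.

(** * Vanishing and linear independence on a fat hook *)

Section Independence.
Local Open Scope ring_scope.

Definition is_shape (L : nat) (s : nat -> nat) : Prop :=
  (forall i, s i.+1 <= s i)%N /\ s L = 0%N.

Lemma is_shape_anti L s i j : is_shape L s -> (i <= j)%N -> (s j <= s i)%N.
Proof.
move=> [sS _]; elim: j => [|j IHj]; first by rewrite leqn0 => /eqP ->.
rewrite leq_eqVlt => /predU1P [-> //|]; rewrite ltnS => /IHj.
exact: leq_trans.
Qed.

Lemma is_shape_geq L s i : is_shape L s -> (L <= i)%N -> s i = 0%N.
Proof.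
move=> sh_s leLi; apply/eqP; rewrite -leqn0 -(proj2 sh_s).
exact: (is_shape_anti sh_s).
Qed.

Lemma shape_of_lt L K (f : {ffun 'I_L -> 'I_K.+1}) k : (shape_of f k < K.+1)%N.
Proof. by rewrite /shape_of; case: insub => [i|] //=; apply: ltn_ord. Qed.

Lemma hstripP L K s (f : {ffun 'I_L -> 'I_K}) : is_shape L s -> hstrip s f ->
  forall i, (s i.+1 <= shape_of f i <= s i)%N.
Proof.
move=> sh_s /forallP st i; have [lt|ge] := ltnP i L.
  by have := st (Ordinal lt); rewrite -shape_ofE.
by rewrite shape_of_geq // (is_shape_geq sh_s) // leqW.
Qed.

Lemma is_shape_hstrip L K s (f : {ffun 'I_L -> 'I_K}) :
  is_shape L s -> hstrip s f -> is_shape L (shape_of f).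
Proof.
move=> sh_s st; split=> [i|]; last exact: shape_of_geq.
case/andP: (hstripP sh_s st i) => le _.
case/andP: (hstripP sh_s st i.+1) => _ le'; exact: leq_trans le' le.
Qed.

(** Splitting off one variable x removes a horizontal strip, and by interlacing row p-1 of what
    remains is still longer than q. After p removals the first row exceeds q, where the functions of
    q negative variables vanish. *)
Lemma jacobi_trudi_hsuper0 (R : comNzRingType) L s (x z : nat -> R) p q :
  is_shape L s -> (p < L)%N -> (q < s p)%N ->
  jacobi_trudi L s (hsuper x z p q) = 0.
Proof.
elim: p s => [|p IHp] s sh_s lt_pL lt_qs.
  by apply: jacobi_trudi0 => // j _; apply: hneg_gt; apply: ltn_addr.
rewrite /= (@jacobi_trudi_hadd _ _ (s 0%N).+1) ?(proj2 sh_s) //; last exact: (proj1 sh_s).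
rewrite big1 // => f st; rewrite IHp ?mulr0 ?(ltnW lt_pL) //.
  exact: is_shape_hstrip st.
by case/andP: (hstripP sh_s st p) => le _; apply: leq_trans le.
Qed.

(** A polynomial vanishing at all natural numbers is zero in characteristic zero; its coefficient of
    degree [D] is the sum in question. *)
Lemma sum_expr_coef0 (R : numDomainType) (I : finType) (d : I -> nat) (a : I -> R) :
  (forall z, \sum_i z ^+ d i * a i = 0) ->
  forall D, \sum_(i | d i == D) a i = 0.
Proof.
move=> a0 D; pose P := \sum_i a i *: 'X^(d i).
have P0 : P = 0.
  apply: (@roots_geq_poly_eq0 _ _ [seq k%:R | k <- iota 0 (size P)]).
  - apply/allP => _ /mapP [k _ ->]; rewrite /root /P horner_sum.
    apply/eqP; rewrite -[RHS](a0 k%:R); apply: eq_bigr => i _.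
    by rewrite hornerZ hornerXn mulrC.
  - by rewrite map_inj_uniq ?iota_uniq // => k l /eqP; rewrite eqr_nat => /eqP.
  - by rewrite size_map size_iota.
have := congr1 (fun P : {poly R} => P`_D) P0; rewrite coef0 coef_sum => E.
rewrite -[RHS]E big_mkcond; apply: eq_bigr => i _.
by rewrite coefZ coefXn eq_sym; case: eqP; rewrite ?mulr1 ?mulr0.
Qed.

Definition lin_indep (R : nzRingType) (T : finType) (A : Type) (good : pred T)
    (J : A -> T -> R) : Prop :=
  forall c : T -> R, (forall r, ~~ good r -> c r = 0) ->
  (forall a, \sum_r c r * J a r = 0) -> forall r, c r = 0.

(* Comparing coefficients of the highest power of one variable z, where
   [tr r] indexes the leading coefficient of the polynomial J' a z r. *)
Lemma lin_indep_peel (R : numDomainType) (T : finType) (A : Type)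
    (good good' : pred T) (J : A -> T -> R) (J' : A * R -> T -> R)
    (rl : rel T) (deg : T -> T -> nat) (tr : T -> T) :
  (forall a z r, good r ->
     J' (a, z) r = \sum_(f | rl r f) z ^+ deg r f * J a f) ->
  (forall r, good r -> good' (tr r) && rl r (tr r)) ->
  (forall r f, good r -> rl r f -> (deg r f <= deg r (tr r))%N) ->
  (forall r f, good r -> rl r f -> deg r f = deg r (tr r) -> f = tr r) ->
  (forall r r', good r -> good r' -> tr r = tr r' ->
     deg r (tr r) = deg r' (tr r') -> r = r') ->
  lin_indep good' J -> lin_indep good J'.
Proof.
move=> J'E good_tr deg_le deg_eq tr_inj indJ c c0 sum0 r1.
apply/eqP/negPn/negP => nz1.
(* [r0] attains the highest leading degree [D] among the indices with nonzero coefficient; [c'] then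
   gives the relation carried by the power [D] of z. *)
have [r0 nz0 max0] := @arg_maxnP _ r1 (fun r => c r != 0) (fun r => deg r (tr r)) nz1.
have nz_good r : c r != 0 -> good r.
  by move=> nz; apply: contraNT nz => /c0 ->.
set D := deg r0 (tr r0) in max0.
pose c' f := \sum_(r | rl r f && (deg r f == D)) c r.
(* Since [D] is maximal, only leading terms can reach it. *)
have lead r f : c r != 0 -> rl r f -> deg r f == D ->
    f = tr r /\ deg r (tr r) = D.
  move=> nz rrf /eqP dD; have gr := nz_good _ nz.
  have eD : deg r f = deg r (tr r).
    by apply/eqP; rewrite eqn_leq deg_le //= dD; exact: max0.
  by rewrite -eD; split=> //; apply: deg_eq.
have c'0 f : c' f = 0.
  apply: indJ => {}f.
    move=> ngf; rewrite /c' big1 // => r /andP [rrf dD].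
    apply/eqP/negPn/negP => nz; case: (lead _ _ nz rrf dD) => ef _.
    by case/andP: (good_tr _ (nz_good _ nz)) => gt _; rewrite ef gt in ngf.
  under eq_bigr do rewrite /c' big_distrl /=.
  rewrite (exchange_big_dep xpredT) //=.
  pose a0 (rf : T * T) := if rl rf.1 rf.2 then c rf.1 * J f rf.2 else 0.
  have := @sum_expr_coef0 _ _ (fun rf => deg rf.1 rf.2) a0 _ D.
  rewrite big_mkcond -(pair_bigA _ (fun r g =>
    if deg r g == D then a0 (r, g) else 0)) /= => E.
  rewrite -[RHS]E => [|z].
    apply: eq_bigr => r _; rewrite big_mkcond; apply: eq_bigr => g _ /=.
    by rewrite /a0 /=; case: (rl r g); case: (deg r g == D).
  rewrite -[RHS](sum0 (f, z)) -(pair_bigA _ (fun r g => z ^+ deg r g * a0 (r, g))) /=.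
  apply: eq_bigr => r _.
  have [cr0|/nz_good gr] := eqVneq (c r) 0.
    by rewrite cr0 mul0r big1 // => g _; rewrite /a0 /= cr0 mul0r if_same mulr0.
  rewrite J'E // big_distrr /= [RHS]big_mkcond; apply: eq_bigr => g _.
  by rewrite /a0 /=; case: ifP; rewrite ?mulr0 // mulrCA.
have gr0 := nz_good _ nz0; case/andP: (good_tr _ gr0) => _ rl0.
case/negP: nz0; rewrite -(c'0 (tr r0)) /c'.
(* A leading term together with its degree determines the index, so [c' (tr r0)] consists of [c r0]
   alone. *)
rewrite (bigD1 r0) /= ?rl0 ?eqxx //.
rewrite big1 ?addr0 // => r /andP [/andP [rrf dD] nr0].
apply/eqP; apply: contraNT nr0 => nz; case: (lead _ _ nz rrf dD) => etr eD.
apply/eqP; apply: tr_inj => //; exact: nz_good.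
Qed.

(** The shapes in the fat hook: those avoiding the cell in row p and column q, both counted from
    0. *)
Definition hook L K (p q : nat) (f : {ffun 'I_L -> 'I_K}) : bool :=
  [forall i : 'I_L, shape_of f i.+1 <= f i]%N && (shape_of f p <= q)%N.

Lemma hook_is_shape L K p q (f : {ffun 'I_L -> 'I_K}) :
  hook p q f -> is_shape L (shape_of f).
Proof.
case/andP=> /forallP anti _; split=> [i|]; last exact: shape_of_geq.
have [lt|ge] := ltnP i L; last by rewrite !shape_of_geq // leqW.
by have := anti (Ordinal lt); rewrite -shape_ofE.
Qed.

Lemma is_shape_hook L K p q (f : {ffun 'I_L -> 'I_K}) :
  is_shape L (shape_of f) -> (shape_of f p <= q)%N -> hook p q f.
Proof.
move=> [anti _] leq; rewrite /hook leq andbT; apply/forallP => i.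
by rewrite -[f i : nat]shape_ofE.
Qed.

Lemma eq_shape_of L K (f g : {ffun 'I_L -> 'I_K}) :
  shape_of f =1 shape_of g -> f = g.
Proof.
by move=> e; apply/ffunP => i; apply/val_inj; rewrite /= -!shape_ofE e.
Qed.

Definition strip_size L K (r f : {ffun 'I_L -> 'I_K}) : nat :=
  (\sum_(i < L) (shape_of r i - f i))%N.

Lemma strip_size_le L K (r f g : {ffun 'I_L -> 'I_K}) :
  (forall i : 'I_L, g i <= f i)%N -> (strip_size r f <= strip_size r g)%N.
Proof. by move=> le; apply: leq_sum => i _; apply: leq_sub2l. Qed.

Lemma strip_size_eq L K (r f g : {ffun 'I_L -> 'I_K}) :
  (forall i : 'I_L, g i <= f i <= shape_of r i)%N ->
  strip_size r f = strip_size r g -> f = g.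
Proof.
move=> le eqD; apply/ffunP => i; apply/val_inj => /=.
have E : (\sum_(k < L) (f k - g k) = 0)%N.
  apply: (@addnI (strip_size r f)); rewrite addn0 [RHS]eqD -big_split /=.
  by apply: eq_bigr => k _; have := le k; lia.
have /eqP := E; rewrite sum_nat_eq0 => /forallP /(_ i) /=.
by have := le i; lia.
Qed.

(** Removes the longest horizontal strip, which amounts to deleting the first row; this gives the
    leading term in a positive variable. *)
Definition drop_row L K (r : {ffun 'I_L -> 'I_K.+1}) : {ffun 'I_L -> 'I_K.+1} :=
  [ffun i : 'I_L => inord (shape_of r i.+1)].

(** Removes the longest vertical strip, which is the first column up to shifting; this gives the
    leading term in a negative variable. *)
Definition drop_col L K (r : {ffun 'I_L -> 'I_K.+1}) : {ffun 'I_L -> 'I_K.+1} :=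
  [ffun i : 'I_L => inord (shape_of r i).-1].

Lemma shape_of_drop_row L K (r : {ffun 'I_L -> 'I_K.+1}) k :
  shape_of (drop_row r) k = shape_of r k.+1.
Proof.
have [lt|ge] := ltnP k L; last by rewrite !shape_of_geq // leqW.
rewrite -[k]/(val (Ordinal lt)) shape_ofE ffunE inordK //.
exact: shape_of_lt.
Qed.

Lemma shape_of_drop_col L K (r : {ffun 'I_L -> 'I_K.+1}) k :
  shape_of (drop_col r) k = (shape_of r k).-1.
Proof.
have [lt|ge] := ltnP k L; last by rewrite !shape_of_geq.
rewrite -[k]/(val (Ordinal lt)) shape_ofE ffunE inordK //.
exact: leq_ltn_trans (leq_pred _) (shape_of_lt _ _).
Qed.

(** All rows but the first can be read off from [drop_row], and the size of the strip then recovers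
    the first. *)
Lemma drop_row_inj L K (r r' : {ffun 'I_L -> 'I_K.+1}) :
  is_shape L (shape_of r) -> is_shape L (shape_of r') ->
  drop_row r = drop_row r' ->
  strip_size r (drop_row r) = strip_size r' (drop_row r') -> r = r'.
Proof.
case: L r r' => [|L] r r' [anti _] [anti' _] edr.
  by move=> _; apply/ffunP => -[].
have eS k : shape_of r k.+1 = shape_of r' k.+1.
  by rewrite -!shape_of_drop_row edr.
rewrite /strip_size !big_ord_recl -!shape_ofE !shape_of_drop_row.
under eq_bigr do rewrite -shape_ofE shape_of_drop_row !lift0 !eS.
under [in RHS]eq_bigr do rewrite -shape_ofE shape_of_drop_row !lift0.
move/addIn => e0; apply: eq_shape_of => -[|k] //.
by move: e0 (anti 0%N) (anti' 0%N) (eS 0%N) => /=; lia.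
Qed.

(** Deleting a column only confuses rows of length 1 with empty rows. The size of the strip counts
    the nonempty rows and so settles which they are. *)
Lemma drop_col_inj L K (r r' : {ffun 'I_L -> 'I_K.+1}) :
  is_shape L (shape_of r) -> is_shape L (shape_of r') ->
  drop_col r = drop_col r' ->
  strip_size r (drop_col r) = strip_size r' (drop_col r') -> r = r'.
Proof.
have key (s s' : {ffun 'I_L -> 'I_K.+1}) i :
    is_shape L (shape_of s) -> is_shape L (shape_of s') -> (i < L)%N ->
    (shape_of s' i = 0)%N -> (0 < shape_of s i)%N ->
    strip_size s (drop_col s) <> strip_size s' (drop_col s').
  move=> sh sh' ltiL s'0 s_gt0; apply/eqP; rewrite neq_ltn; apply/orP; right.
  rewrite /strip_size (bigD1 (Ordinal ltiL)) // [X in (_ < X)%N](bigD1 (Ordinal ltiL)) //=.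
  rewrite -!shape_ofE !shape_of_drop_col /= s'0 sub0n add0n.
  have -> : (shape_of s i - (shape_of s i).-1 = 1)%N by lia.
  rewrite add1n ltnS; apply: leq_sum => k _.
  rewrite -!shape_ofE !shape_of_drop_col.
  have [leki|ltik] := leqP k i.
    by have := is_shape_anti sh leki; lia.
  by have := is_shape_anti sh' (ltnW ltik); lia.
move=> sh sh' edr esz; apply: eq_shape_of => k.
have [lt|ge] := ltnP k L; last by rewrite !shape_of_geq.
have eP : (shape_of r k).-1 = (shape_of r' k).-1 by rewrite -!shape_of_drop_col edr.
case E: (shape_of r k) eP => [|a]; case E': (shape_of r' k) => [|b] //=.
- move=> b0; case: (@key r' r k) => //; by rewrite E'.
- move=> b0; case: (@key r r' k) => //; by rewrite E.
- by move=> ->.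
Qed.

Lemma eq_hsuper (R : nzRingType) (x x' z z' : nat -> R) p q :
  (forall i, (i < p)%N -> x i = x' i) -> (forall i, (i < q)%N -> z i = z' i) ->
  hsuper x z p q = hsuper x' z' p q.
Proof.
move=> ex ez; elim: p ex => [|p IHp] ex /=.
  elim: q ez => //= q IHq ez; rewrite ez // IHq // => i lti.
  by apply: ez; apply: ltnW.
by rewrite ex // IHp // => i lti; apply: ex; apply: ltnW.
Qed.

(** Induction peels off the positive variables, each shortening the hook by a row, then the negative
    ones, each narrowing it by a column. *)
Lemma jacobi_trudi_indep (R : numDomainType) L K p q :
  lin_indep (hook p q) (fun xz (f : {ffun 'I_L -> 'I_K.+1}) =>
    jacobi_trudi L (shape_of f) (hsuper xz.1 xz.2 p q) : R).
Proof.
elim: p => [|p IHp].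
  elim: q => [|q IHq].
    move=> c c0 sum0 f0; have [hf0|/c0//] := boolP (hook 0 0 f0).
    (* The empty shape is the only one in this hook, and its determinant is 1. *)
    have hook0 f : hook 0 0 f -> forall k, shape_of f k = 0%N.
      move=> hf k; apply/eqP; rewrite -leqn0.
      case/andP: (hf) => _; apply: leq_trans.
      exact: (is_shape_anti (hook_is_shape hf)).
    have := sum0 (fun=> 0, fun=> 0); rewrite (bigD1 f0) //= big1 => [|f nf].
      by rewrite addr0 jacobi_trudi_hempty ?mulr1 // => i _; apply: hook0.
    rewrite c0 ?mul0r //; apply: contra nf => hf; apply/eqP/eq_shape_of => k.
    by rewrite !hook0.
  move=> c c0 sum0.
  (* The sign in [hrem (- a.2)] turns the branching rule into an expansion in powers of [a.2]
     itself. *)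
  have peel : lin_indep (hook 0 q.+1)
    (fun (a : ((nat -> R) * (nat -> R)) * R) (f : {ffun 'I_L -> 'I_K.+1}) =>
       jacobi_trudi L (shape_of f) (hrem (- a.2) (hsuper a.1.1 a.1.2 0 q)) : R).
    apply: (lin_indep_peel (rl := fun r f => vstrip (shape_of r) f)
              (deg := @strip_size L K.+1) (tr := @drop_col L K) _ _ _ _ _ IHq).
    - move=> a z r /hook_is_shape sh /=.
      rewrite (@jacobi_trudi_hrem _ _ K.+1) ?opprK ?(proj2 sh) ?shape_of_lt //.
      exact: (proj1 sh).
    - move=> r hr; have [anti sh0] := hook_is_shape hr.
      have shd : is_shape L (shape_of (drop_col r)).
        split=> [i|]; last exact: shape_of_geq.
        by rewrite !shape_of_drop_col; have := anti i; lia.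
      apply/andP; split.
        apply: is_shape_hook => //; rewrite shape_of_drop_col.
        by case/andP: hr; lia.
      apply/andP; split; apply/forallP => i; rewrite -shape_ofE.
        exact: (proj1 shd).
      by rewrite shape_of_drop_col; lia.
    - move=> r f _ /andP [_ /forallP st]; apply: strip_size_le => i.
      by have := st i; rewrite -[drop_col r i : nat]shape_ofE shape_of_drop_col; lia.
    - move=> r f _ /andP [_ /forallP st]; apply: strip_size_eq => i.
      by have := st i; rewrite -[drop_col r i : nat]shape_ofE shape_of_drop_col; lia.
    - move=> r r' /hook_is_shape sh /hook_is_shape sh'; exact: drop_col_inj.
  apply: peel => // -[[x z] y].
  (* The peeled parameter is realised by overwriting the variable of index [q]; the inner alphabet
     only uses indices below [q]. *)
  rewrite -[RHS](sum0 (x, fun i => if i == q then - y else z i)) /=.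
  apply: eq_bigr => f _; rewrite eqxx.
  rewrite -[hneg z q]/(hsuper x z 0 q) -[hneg _ q]/(hsuper x _ 0 q).
  congr (_ * jacobi_trudi _ _ (hrem _ _)).
  by apply: eq_hsuper => // i lti; rewrite ltn_eqF.
move=> c c0 sum0.
have peel : lin_indep (hook p.+1 q)
  (fun (a : ((nat -> R) * (nat -> R)) * R) (f : {ffun 'I_L -> 'I_K.+1}) =>
     jacobi_trudi L (shape_of f) (hadd a.2 (hsuper a.1.1 a.1.2 p q)) : R).
  apply: (lin_indep_peel (rl := fun r f => hstrip (shape_of r) f)
            (deg := @strip_size L K.+1) (tr := @drop_row L K) _ _ _ _ _ IHp).
  - move=> a z r /hook_is_shape sh /=.
    rewrite (@jacobi_trudi_hadd _ _ K.+1) ?(proj2 sh) ?shape_of_lt //.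
    exact: (proj1 sh).
  - move=> r hr; have [anti sh0] := hook_is_shape hr.
    have shd : is_shape L (shape_of (drop_row r)).
      by split=> [i|]; [rewrite !shape_of_drop_row | exact: shape_of_geq].
    apply/andP; split.
      apply: is_shape_hook => //; rewrite shape_of_drop_row.
      by case/andP: hr.
    apply/forallP => i; rewrite -[drop_row r i : nat]shape_ofE shape_of_drop_row.
    by rewrite leqnn anti.
  - move=> r f _ /forallP st; apply: strip_size_le => i.
    by have := st i; rewrite -[drop_row r i : nat]shape_ofE shape_of_drop_row; lia.
  - move=> r f _ /forallP st; apply: strip_size_eq => i.
    by have := st i; rewrite -[drop_row r i : nat]shape_ofE shape_of_drop_row; lia.
  - move=> r r' /hook_is_shape sh /hook_is_shape sh'; exact: drop_row_inj.
apply: peel => // -[[x z] y].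
rewrite -[RHS](sum0 (fun i => if i == p then y else x i, z)) /=.
apply: eq_bigr => f _; rewrite eqxx.
congr (_ * jacobi_trudi _ _ (hadd _ _)).
by apply: eq_hsuper => // i lti; rewrite ltn_eqF.
Qed.
End Independence.

(** * The Jacobi-Trudi formula for tableaux *)

Section SchurJacobiTrudi.
Local Open Scope ring_scope.

(* The box 'I_L * 'I_W does not depend on the shape s, so that the tableaux of
   all shapes met when peeling off letters live in one type. *)
Definition stab L W m (k : nat) (s : nat -> nat)
    (t : {ffun 'I_L * 'I_W -> 'I_m}) : bool :=
  [&& [forall i : 'I_L, forall j : 'I_W, (s i <= j)%N ==> (val (t (i, j)) == 0%N)],
      [forall i : 'I_L, forall j : 'I_W, (j < s i)%N ==> (t (i, j) < k)%N],
      [forall i : 'I_L, forall j1 : 'I_W, forall j2 : 'I_W,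
         ((j1 < j2) && (j2 < s i))%N ==> (t (i, j1) <= t (i, j2))%N] &
      [forall i1 : 'I_L, forall i2 : 'I_L, forall j : 'I_W,
         ((i1 < i2) && (j < s i2))%N ==> (t (i1, j) < t (i2, j))%N]].

Lemma stabP L W m k s (t : {ffun 'I_L * 'I_W -> 'I_m}) :
  reflect [/\ forall i j, (s (val i) <= val j)%N -> t (i, j) = 0%N :> nat,
              forall i j, (val j < s (val i))%N -> (t (i, j) < k)%N,
              forall i (j1 j2 : 'I_W), (j1 < j2)%N -> (j2 < s (val i))%N ->
                (t (i, j1) <= t (i, j2))%N &
              forall (i1 i2 : 'I_L) (j : 'I_W), (i1 < i2)%N -> (j < s i2)%N ->
                (t (i1, j) < t (i2, j))%N]
          (stab k s t).
Proof.
apply: (iffP and4P) => -[H1 H2 H3 H4]; split.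
- by move=> i j le; apply/eqP/(implyP (forallP (forallP H1 i) j)).
- by move=> i j le; apply/(implyP (forallP (forallP H2 i) j)).
- move=> i j1 j2 lt1 lt2; apply/(implyP (forallP (forallP (forallP H3 i) j1) j2)).
  by rewrite lt1.
- move=> i1 i2 j lt1 lt2; apply/(implyP (forallP (forallP (forallP H4 i1) i2) j)).
  by rewrite lt1.
- by apply/forallP => i; apply/forallP => j; apply/implyP => le; apply/eqP/H1.
- by apply/forallP => i; apply/forallP => j; apply/implyP; apply: H2.
- apply/forallP => i; apply/forallP => j1; apply/forallP => j2.
  by apply/implyP => /andP []; apply: H3.
- apply/forallP => i1; apply/forallP => i2; apply/forallP => j.
  by apply/implyP => /andP []; apply: H4.
Qed.

Definition stab_sum (R : comNzRingType) L W m (y : nat -> R) (k : nat) (s : nat -> nat) : R :=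
  \sum_(t : {ffun 'I_L * 'I_W -> 'I_m} | stab k s t)
    \prod_(ij : 'I_L * 'I_W | (ij.2 < s ij.1)%N) y (t ij).

Lemma initial_segment (a : pred nat) W :
  (forall j j', (j <= j')%N -> (j' < W)%N -> a j' -> a j) ->
  forall j, (j < W)%N -> a j = (j < find (predC a) (iota 0 W))%N.
Proof.
move=> mono j ltjW; case: ltnP => [lt|ge].
  by have := before_find 0%N lt; rewrite nth_iota // add0n /= => /negbFE.
apply/negP => aj; have ltW := leq_ltn_trans ge ltjW.
have hasa : has (predC a) (iota 0 W) by rewrite has_find size_iota.
have := nth_find 0%N hasa; rewrite nth_iota // add0n /= => /negP; apply.
exact: mono ge ltjW aj.
Qed.

(* Row lengths of the subtableau formed by the entries smaller than k. *)
Definition inner_shape L W m (k : nat) (s : nat -> nat)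
    (t : {ffun 'I_L * 'I_W -> 'I_m}) : {ffun 'I_L -> 'I_W.+1} :=
  [ffun i : 'I_L => inord (find (predC (fun j : nat =>
     [exists j' : 'I_W, [&& j' == j :> nat, j < s i & t (i, j') < k]]%N))
     (iota 0 W))].

(** Rows increase weakly, so the entries below [k] fill an initial segment of each row. *)
Lemma inner_shapeP L W m k s (t : {ffun 'I_L * 'I_W -> 'I_m}) (i : 'I_L) (j : 'I_W) :
  stab k.+1 s t ->
  ((j < s i) && (t (i, j) < k) = (j < inner_shape k s t i))%N.
Proof.
case/stabP => _ _ rows _; rewrite ffunE inordK; last first.
  by rewrite ltnS -[X in (_ <= X)%N](size_iota 0 W) find_size.
rewrite -initial_segment //.
  apply/idP/existsP => [H|[j' /and3P [/eqP/val_inj -> -> ->]]//].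
  by exists j; rewrite eqxx.
move=> a b leab ltb /existsP [b' /and3P [/eqP eb lts ltk]].
have ltaW := leq_ltn_trans leab ltb; apply/existsP; exists (Ordinal ltaW).
rewrite /= eqxx (leq_ltn_trans leab lts) /=.
move: leab; rewrite leq_eqVlt => /predU1P [eab|ltab].
  by rewrite (_ : Ordinal _ = b') //; apply: val_inj; rewrite /= eb.
by apply: leq_ltn_trans (rows i _ b' _ _) ltk; rewrite eb.
Qed.

(** Columns increase strictly, so a cell lying above another cell of the shape has an entry below
    [k]; row i of the inner shape thus reaches length s_(i+1). *)
Lemma hstrip_inner_shape L W m k s (t : {ffun 'I_L * 'I_W -> 'I_m}) :
  is_shape L s -> (s 0%N <= W)%N -> stab k.+1 s t -> hstrip s (inner_shape k s t).
Proof.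
move=> sh_s leW st; apply/forallP => i; apply/andP; split.
  rewrite leqNgt; apply/negP => lt.
  have leS : (s i.+1 <= s i)%N by exact: (proj1 sh_s).
  have leWi : (s i.+1 <= W)%N by apply: leq_trans leW; apply: (is_shape_anti sh_s).
  have ltL : (i.+1 < L)%N.
    by rewrite ltnNge; apply/negP => ge; rewrite (is_shape_geq sh_s) in lt.
  have ltW := leq_trans lt leWi.
  have := inner_shapeP i (Ordinal ltW) st; rewrite /= ltnn (leq_trans lt leS) /= => /negbT.
  rewrite -leqNgt => gek; case/stabP: st => _ bd _ cols.
  have := leq_ltn_trans gek (cols i (Ordinal ltL) (Ordinal ltW) (ltnSn i) lt).
  by rewrite ltnNge -ltnS bd.
rewrite leqNgt; apply/negP => lt.
have ltW : (s i < W)%N by apply: leq_trans lt _; rewrite -ltnS.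
by have := inner_shapeP i (Ordinal ltW) st; rewrite /= ltnn lt.
Qed.

(** Tableaux are grouped by the shape of their entries below [k]; the remaining cells form a
    horizontal strip and all contain [k]. *)
Lemma stab_sum_rec (R : comNzRingType) L W m (y : nat -> R) k s :
  is_shape L s -> (s 0 <= W)%N -> (k < m.+1)%N ->
  stab_sum L W m.+1 y k.+1 s =
  \sum_(f : {ffun 'I_L -> 'I_W.+1} | hstrip s f)
    y k ^+ (\sum_(i < L) (s i - f i)) * stab_sum L W m.+1 y k (shape_of f).
Proof.
move=> sh_s leW ltkm; rewrite /stab_sum.
rewrite (partition_big (inner_shape k s) (hstrip s)); last first.
  by move=> t; apply: hstrip_inner_shape.
apply: eq_bigr => f st_f.
have fP := hstripP sh_s st_f.
have f_le (i : 'I_L) : (f i <= s i)%N by rewrite -shape_ofE; case/andP: (fP i).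
have f_ge (i1 i2 : 'I_L) : (i1 < i2)%N -> (s i2 <= f i1)%N.
  move=> lt; rewrite -shape_ofE; case/andP: (fP i1) => le _.
  exact: leq_trans (is_shape_anti sh_s lt) le.
(* [paste] fills the strip with [k] and [restr] erases it; they are inverse bijections between
   tableaux of shape [f] with entries below [k] and tableaux of shape [s] with inner shape [f]. *)
pose paste (t : {ffun 'I_L * 'I_W -> 'I_m.+1}) : {ffun 'I_L * 'I_W -> 'I_m.+1} :=
  [ffun ij : 'I_L * 'I_W => if (ij.2 < f ij.1)%N then t ij
              else if (ij.2 < s ij.1)%N then inord k else ord0].
pose restr (t : {ffun 'I_L * 'I_W -> 'I_m.+1}) : {ffun 'I_L * 'I_W -> 'I_m.+1} :=
  [ffun ij : 'I_L * 'I_W => if (ij.2 < f ij.1)%N then t ij else ord0].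
rewrite (reindex_onto paste restr); last first.
  move=> t /andP [st /eqP ef]; apply/ffunP => -[i j]; rewrite !ffunE /=.
  have := inner_shapeP i j st; rewrite ef; case/stabP: st => z bd _ _.
  case: (ltnP j (f i)) => // lefj; case: (ltnP j (s i)) => /= [ltjs|lesj _].
    move/negbT; rewrite -leqNgt => ge.
    apply: val_inj; rewrite /= inordK //; apply/eqP.
    by rewrite eqn_leq ge -ltnS bd.
  by apply: val_inj; rewrite /= z.
rewrite big_distrr /=; apply: eq_big => [t|t _].
  apply/idP/idP => [/andP [/andP [st /eqP ef] /eqP <-]|st].
    have cut := inner_shapeP _ _ st; rewrite ef in cut.
    case/stabP: (st) => z bd rows cols.
    apply/stabP; split=> [i j|i j|i j1 j2 lt12|i1 i2 j lt12].
    - by rewrite shape_ofE [restr _ _]ffunE /= => le; rewrite ltnNge le.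
    - rewrite shape_ofE [restr _ _]ffunE /= => lt; rewrite lt.
      by have := cut i j; rewrite lt => /andP [].
    - rewrite shape_ofE ![restr _ _]ffunE /= => lt.
      rewrite lt (ltn_trans lt12 lt); apply: rows => //.
      exact: leq_trans lt (f_le i).
    - rewrite shape_ofE ![restr _ _]ffunE /= => lt.
      have lts := leq_trans lt (f_le i2).
      rewrite lt (leq_trans lts (f_ge _ _ lt12)); exact: cols.
  case/stabP: (st) => z bd rows cols.
  have st' : stab k.+1 s (paste t).
    apply/stabP; split=> [i j|i j|i j1 j2 lt12|i1 i2 j lt12].
    - move=> le; rewrite ffunE /= ltnNge (leq_trans (f_le i) le) /=.
      by rewrite ltnNge le.
    - move=> lt; rewrite ffunE /= lt; case: (ltnP j (f i)) => [ltf|_]; last by rewrite inordK.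
      by apply: ltnW; apply: bd; rewrite shape_ofE.
    - move=> lt; rewrite !ffunE /= lt (ltn_trans lt12 lt).
      case: (ltnP j2 (f i)) => [lt2|le2].
        by rewrite (ltn_trans lt12 lt2); apply: rows => //; rewrite shape_ofE.
      rewrite inordK //; case: (ltnP j1 (f i)) => [lt1|_]; last by rewrite inordK.
      by apply: ltnW; apply: bd; rewrite shape_ofE.
    - move=> lt; have lt1 := leq_trans lt (f_ge _ _ lt12).
      rewrite !ffunE /= lt lt1; case: (ltnP j (f i2)) => [lt2|_].
        by apply: cols => //; rewrite shape_ofE.
      by rewrite inordK //; apply: bd; rewrite shape_ofE.
  rewrite st' /=; apply/andP; split; apply/eqP; apply/ffunP.
    move=> i; have cut j := inner_shapeP i j st'.
    have same (j : 'I_W) : (j < inner_shape k s (paste t) i)%N = (j < f i)%N.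
      rewrite -cut ffunE /=; case: (ltnP j (f i)) => [lt|le].
        rewrite (leq_trans lt (f_le i)) /=; apply: bd; by rewrite shape_ofE.
      by case: (ltnP j (s i)) => //= _; rewrite inordK // ltnn.
    apply: val_inj => /=; apply/eqP; rewrite eqn_leq.
    have ltf : (f i < W.+1)%N by [].
    have lti : (inner_shape k s (paste t) i < W.+1)%N by [].
    apply/andP; split; rewrite leqNgt; apply/negP => lt.
      have ltW : (f i < W)%N by apply: leq_trans lt _.
      by have := same (Ordinal ltW); rewrite /= lt ltnn.
    have ltW : (inner_shape k s (paste t) i < W)%N by apply: leq_trans lt _.
    by have := same (Ordinal ltW); rewrite /= lt ltnn.
  move=> [i j]; rewrite !ffunE /=; case: (ltnP j (f i)) => // le.
  by apply: val_inj; rewrite /= z // shape_ofE.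
(* The weight factors into a power of [y k] from the strip and the weight of the inner tableau. *)
rewrite (bigID (fun ij : 'I_L * 'I_W => (ij.2 < f ij.1)%N)) /= mulrC; congr (_ * _).
  transitivity (\prod_(ij : 'I_L * 'I_W | (f ij.1 <= ij.2 < s ij.1)%N) y k).
    apply: eq_big => [[i j]|[i j] /andP [lt /negPf nlt]] /=.
      by rewrite -leqNgt andbC.
    by rewrite ffunE /= lt nlt inordK.
  rewrite -(pair_big_dep xpredT (fun i j : 'I__ => (f i <= j < s i)%N) (fun _ _ => y k)) /=.
  rewrite expr_sum; apply: eq_bigr => i _.
  rewrite (big_ord_interval _ (fun=> y k)) ?prodr_const_nat //.
  exact: leq_trans (is_shape_anti sh_s (leq0n i)) leW.
apply: eq_big => [[i j]|[i j] /andP [_ lt]] /=.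
  rewrite shape_ofE andbC; case: (ltnP j (f i)) => //= lt.
  exact: leq_trans lt (f_le i).
by rewrite ffunE /= lt.
Qed.

(** Both sides obey the same branching rule. With no letters left, both are 1 for the empty shape
    and 0 for any other. *)
Lemma stab_sum_jacobi_trudi (R : comNzRingType) L W m (y z : nat -> R) k s :
  is_shape L s -> (s 0 <= W)%N -> (k <= m.+1)%N ->
  stab_sum L W m.+1 y k s = jacobi_trudi L s (hsuper y z k 0).
Proof.
elim: k s => [|k IHk] s sh_s leW lekm; last first.
  rewrite stab_sum_rec //= (@jacobi_trudi_hadd _ _ W.+1) ?(proj2 sh_s) //; last exact: (proj1 sh_s).
  apply: eq_bigr => f st; rewrite IHk ?(ltnW lekm) //.
    exact: is_shape_hstrip st.
  by case/andP: (hstripP sh_s st 0) => _ le; apply: leq_trans leW.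
have [s0|s_gt0] := posnP (s 0%N).
  have sz i : s i = 0%N.
    by apply/eqP; rewrite -leqn0 -s0; apply: (is_shape_anti sh_s).
  rewrite jacobi_trudi_hempty // /stab_sum.
  rewrite (big_pred1 [ffun=> ord0]) => [|t]; first by rewrite big1 // => ij; rewrite sz.
  apply/stabP/eqP => [[z0 _ _ _]|->].
    by apply/ffunP => -[i j]; apply: val_inj; rewrite ffunE /= z0 ?sz.
  by split=> [i j|i j|i j1 j2|i1 i2 j]; rewrite ?ffunE ?sz.
have L_gt0 : (0 < L)%N.
  by rewrite lt0n; apply/eqP => L0; move: sh_s.2 s_gt0; rewrite L0 => ->.
rewrite jacobi_trudi0 //; last first.
  by move=> j _; rewrite /= /hempty addn_eq0 eqn0Ngt s_gt0.
rewrite /stab_sum big1 // => t /stabP [_ bd _ _].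
by have := bd (Ordinal L_gt0) (Ordinal (leq_trans s_gt0 leW)) s_gt0.
Qed.

Lemma is_shape_nth la : sorted geq la -> is_shape (size la) (nth 0%N la).
Proof.
move=> srt; split=> [i|]; last by rewrite nth_default.
have [lt|ge] := ltnP i.+1 (size la); last by rewrite nth_default.
by apply: (sortedP 0%N srt).
Qed.

Lemma schur_eval_jacobi_trudi (R : comNzRingType) m la (y z : nat -> R) :
  (0 < m)%N -> sorted geq la ->
  schur_eval la (fun i : 'I_m => y i) =
  jacobi_trudi (size la) (nth 0%N la) (hsuper y z m 0).
Proof.
case: m => // m _ srt.
have leW : (nth 0 la 0 <= head 0 la)%N by rewrite nth0.
rewrite -(@stab_sum_jacobi_trudi _ _ _ m y z _ _ (is_shape_nth srt) leW) //.
apply: eq_bigl => t; rewrite /ssyt /stab; congr (_ && _).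
(* The clause bounding the entries is automatic once all letters are allowed. *)
rewrite [X in _ = X && _](_ : _ = true) //; apply/forallP => i.
by apply/forallP => j; rewrite ltn_ord implybT.
Qed.
End SchurJacobiTrudi.

(** * Evaluating the plethysm *)

Section Plethysm.
Local Open Scope ring_scope.

(** The point [u] lists the roots of the monic polynomial whose coefficients are the complete
    functions of the opposite alphabet z - x. By Vieta these are the complete functions of -u up to
    degree [N], and Newton's identities transfer the equality to power sums. *)
Lemma exists_power_sums (C : numClosedFieldType) (x z : nat -> C) p q N :
  exists u : nat -> C, forall k, (0 < k <= N)%N ->
    \sum_(i < N) u i ^+ k = psuper x z p q k.
Proof.
pose h := hsuper z x q p; have newt_h := newton_hsuper z x q p.
have h0 : h 0%N = 1 := proj1 newt_h.
pose P := \poly_(m < N.+1) h (N - m)%N.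
have PN : P`_N = 1 by rewrite coef_poly leqnn subnn.
have szP : size P = N.+1.
  by rewrite size_poly_eq //= subnn h0 oner_eq0.
have [rs] := closed_field_poly_normal P.
rewrite lead_coefE szP PN scale1r => defP.
have szrs : size rs = N.
  by move: szP; rewrite defP size_prod_XsubC => -[].
pose u i := rs`_i; exists u.
have newt_u := newton_hsuper u u 0 N.
move=> k kN; apply: oppr_inj.
have := newton_inj_p newt_u newt_h _ kN; rewrite /psuper big_ord0 sub0r opprB; apply.
move=> n lenN; rewrite /= hneg_prod_XsubC //.
transitivity P`_(N - n); last by rewrite coef_poly ltnS leq_subr subKn.
by rewrite defP (big_nth 0) big_mkord szrs.
Qed.

Lemma rmorph_tab_weight (R S : comPzRingType) (f : {rmorphism R -> S}) m la
    (y : 'I_m -> R) (t : tabT la m) :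
  f (tab_weight y t) = tab_weight (fun i => f (y i)) t.
Proof. by rewrite /tab_weight rmorph_prod. Qed.

Lemma rmorph_schur_eval (R S : comPzRingType) (f : {rmorphism R -> S}) m la
    (y : 'I_m -> R) :
  f (schur_eval la y) = schur_eval la (fun i => f (y i)).
Proof.
rewrite /schur_eval rmorph_sum; apply: eq_bigr => t _; exact: rmorph_tab_weight.
Qed.

Lemma eq_schur_eval (R : comPzRingType) m la (y y' : 'I_m -> R) :
  y =1 y' -> schur_eval la y = schur_eval la y'.
Proof. by move=> e; apply: eq_bigr => t _; apply: eq_bigr => ij _; rewrite e. Qed.

Lemma tab_weightX (R : comPzRingType) m la (y : 'I_m -> R) (t : tabT la m) r :
  tab_weight y t ^+ r = tab_weight (fun i => y i ^+ r) t.
Proof. by rewrite /tab_weight -prodrXl. Qed.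

Lemma schur_eval0 (R : comPzRingType) la (y : 'I_0 -> R) :
  is_part la -> la != [::] -> schur_eval la y = 0.
Proof.
case: la => // a la /andP [_]; rewrite inE negb_or => /andP [a0 _] _.
rewrite /schur_eval big1 // => t _.
have lta : (0 < a)%N by rewrite lt0n eq_sym.
by have [] := t (ord0 : 'I_(size (a :: la)), Ordinal (lta : (0 < head 0 (a :: la))%N)).
Qed.

Lemma size_le_sumn (la : seq nat) : 0%N \notin la -> (size la <= sumn la)%N.
Proof.
by elim: la => //= a la IHla; rewrite inE negb_or => /andP [a0 /IHla]; lia.
Qed.

(** Every other row has at least one cell. This bounds all indices in the Jacobi-Trudi matrix by
    |la|. *)
Lemma nth_size_le_sumn (la : seq nat) i : 0%N \notin la -> (i < size la)%N ->
  (nth 0 la i + size la <= (sumn la).+1)%N.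
Proof.
elim: la i => // a la IHla i; rewrite inE negb_or => /andP [a0 nz].
case: i => [_|i /= lti]; first by have := size_le_sumn nz; rewrite /=; lia.
by move: (IHla _ nz lti) => /=; lia.
Qed.

(** The determinant only involves complete functions of degree at most |la|, which the power sums in
    these degrees determine. *)
Lemma schur_eval_super (C : numDomainType) N la (u x z : nat -> C) p q :
  (0 < N)%N -> is_part la ->
  (forall k, (0 < k <= sumn la)%N -> \sum_(i < N) u i ^+ k = psuper x z p q k) ->
  schur_eval la (fun i : 'I_N => u i) =
  jacobi_trudi (size la) (nth 0%N la) (hsuper x z p q).
Proof.
move=> N_gt0 /andP [srt nz] eqp; rewrite (schur_eval_jacobi_trudi _ u) //.
apply: eq_jacobi_trudi => // i j lti ltj.
apply: (newton_inj_h (newton_hsuper u u N 0) (newton_hsuper x z p q) (N := sumn la)).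
  by move=> k kle; rewrite -eqp // /psuper big_ord0 subr0.
by have := nth_size_le_sumn nz lti; lia.
Qed.

Lemma schur_eval_super0 (C : numDomainType) N la (u x z : nat -> C) p q :
  (0 < N)%N -> is_part la -> (q < nth 0 la p)%N ->
  (forall k, (0 < k <= sumn la)%N -> \sum_(i < N) u i ^+ k = psuper x z p q k) ->
  schur_eval la (fun i : 'I_N => u i) = 0.
Proof.
move=> N_gt0 pla ltq eqp; rewrite (schur_eval_super N_gt0 pla eqp).
apply: jacobi_trudi_hsuper0 => //.
  by apply: is_shape_nth; case/andP: pla.
by rewrite ltnNge; apply: contraTN ltq => ge; rewrite nth_default.
Qed.

Lemma plethysm_eval0 (C : numDomainType) N mu nu (u x z : nat -> C) p q :
  (0 < N)%N -> is_part mu -> mu != [::] -> is_part nu -> (q < nth 0 nu p)%N ->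
  (forall k, (0 < k <= sumn mu * sumn nu)%N ->
     \sum_(i < N) u i ^+ k = psuper x z p q k) ->
  mmap intr (fun i : 'I_N => u i) (plethysm N mu nu) = 0 :> C.
Proof.
move=> N_gt0 pmu mu0 pnu ltq eqp.
rewrite /plethysm rmorph_schur_eval; set ms := schur_monomials N nu.
pose ev := mmap (intr : int -> C) (fun i : 'I_N => u i).
(* Without monomials the alphabet is empty, and s_mu vanishes there because mu is nonempty. *)
have [M0|M_gt0] := posnP (size ms).
  move: (fun k : 'I__ => _) => y; move: y; rewrite M0 => y.
  exact: schur_eval0.
pose y k := ev ms`_k.
transitivity (schur_eval mu (fun k : 'I_(size ms) => y k)); first by [].
rewrite (schur_eval_jacobi_trudi y y M_gt0) ?(andP pmu).1 //.
have mu_gt0 : (0 < size mu)%N by rewrite lt0n size_eq0.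
have mu0_gt0 : (0 < nth 0 mu 0)%N.
  case/andP: pmu => _; case: (mu) mu0 => // a l _; rewrite inE negb_or.
  by case/andP => a0 _; rewrite lt0n eq_sym.
(* The first row suffices: its indices mu_1 + j lie between 1 and |mu|, where the complete functions
   agree with those of the empty alphabet. *)
apply: jacobi_trudi0 => // j ltj.
rewrite (@newton_inj_h _ _ _ _ (hempty C) (sumn mu) (newton_hsuper y y _ 0) (newton_hempty C)).
- by rewrite /hempty addn_eq0 eqn0Ngt mu0_gt0.
- move=> r /andP [r_gt0 r_le]; rewrite /psuper big_ord0 subr0.
  transitivity (schur_eval nu (fun i : 'I_N => u i ^+ r)).
    rewrite -(big_mkord xpredT (fun k => y k ^+ r)) -(big_nth 0 xpredT (fun w => ev w ^+ r)).
    rewrite /ms /schur_monomials big_map big_filter big_enum_cond /schur_eval.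
    apply: eq_bigr => t _; rewrite /ev rmorph_tab_weight tab_weightX.
    by apply: eq_bigr => ij _; rewrite /= mmapX mmap1U.
  apply: (@schur_eval_super0 _ _ _ (fun i => u i ^+ r) (fun i => x i ^+ r) (fun i => z i ^+ r) p q) => //.
  move=> k /andP [k_gt0 k_le].
  under eq_bigr do rewrite -exprM.
  (* The k-th power sum of u^r is the (r k)-th power sum of [u], and r k is at most |mu| |nu|. *)
  rewrite eqp ?muln_gt0 ?r_gt0 ?k_gt0 ?leq_mul // /psuper.
  by congr (_ - _); apply: eq_bigr => i _; rewrite exprM.
- by have := nth_size_le_sumn (andP pmu).2 mu_gt0; lia.
Qed.

Lemma parts_auxP fuel n k la : la \in parts_aux fuel n k ->
  [/\ sumn la = n, path geq k la & 0%N \notin la].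
Proof.
elim: fuel n k la => [|fuel IHf] n k la /=.
  by case: eqP => // ->; rewrite inE => /eqP ->.
case: eqP => [->|_]; first by rewrite inE => /eqP ->.
case/flatten_mapP => a; rewrite mem_iota => lea /mapP [l /IHf [sl pl nz] ->].
split=> /=; first by rewrite sl; lia.
  by rewrite pl andbT; lia.
by rewrite inE negb_or nz andbT; lia.
Qed.

Lemma partsP n la : la \in parts n -> is_part la /\ sumn la = n.
Proof.
case/parts_auxP => sl pl nz; split=> //; rewrite /is_part nz andbT.
exact: path_sorted pl.
Qed.

Lemma eq_part (la la' : seq nat) : is_part la -> is_part la' ->
  nth 0%N la =1 nth 0%N la' -> la = la'.
Proof.
have le l l' : is_part l -> nth 0%N l =1 nth 0%N l' -> (size l <= size l')%N.
  case/andP=> _ nz e; rewrite leqNgt; apply/negP => lt.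
  by move: nz; rewrite -(nth_default 0%N (leqnn (size l'))) -e mem_nth.
move=> p p' e; apply: (@eq_from_nth _ 0%N) => //.
by apply/eqP; rewrite eqn_leq !le // => k; rewrite e.
Qed.
End Plethysm.

(* Work in N = |mu|*|nu| variables (the degree of s_mu o s_nu), where the
   Schur polynomials s_la, la |- N, form a basis of the symmetric polynomials
   of degree N; c la is then the plethysm coefficient a^la_{mu[nu]}. *)
Theorem mainTheorem5 (mu nu : seq nat) (c : seq nat -> int) :
  is_part mu -> is_part nu -> mu != [::] ->
  plethysm (sumn mu * sumn nu) mu nu =
    (\sum_(la <- parts (sumn mu * sumn nu))
        c la *: schur (sumn mu * sumn nu) la)%R ->
  forall la, la \in parts (sumn mu * sumn nu) -> c la != 0%R ->
  forall i, nth 0 nu i <= nth 0 la i.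
Proof.
move=> pmu pnu mu0 plE la0 la0P nz p; rewrite leqNgt; apply/negP => lt_la0.
(* With q = nu_(p+1) - 1, the cell in row p and column q lies in [nu] but not in [la0]. *)
case nu_p: (nth 0 nu p) lt_la0 => [//|q]; rewrite ltnS => le_la0.
have ltq : q < nth 0 nu p by rewrite nu_p.
set N := sumn mu * sumn nu in plE la0P.
have N_gt0 : 0 < N.
  have pos l : is_part l -> 0 < size l -> 0 < sumn l.
    by case/andP => _; case: l => //= a l; rewrite inE negb_or; lia.
  rewrite muln_gt0 !pos // ?lt0n ?size_eq0 //.
  by apply: contraTneq ltq => ->; rewrite nth_nil.
(* Every partition of [N] has at most [N] rows, of length at most [N], so one finite type holds all
   the shapes. *)
pose shp (la : seq nat) : {ffun 'I_N -> 'I_N.+1} := [ffun i : 'I_N => inord (nth 0 la i)].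
have shpE (la : seq nat) : la \in parts N -> shape_of (shp la) =1 nth 0 la.
  case/partsP => pla sla k; have := nth_size_le_sumn (andP pla).2.
  rewrite sla => bd; have [ltk|gek] := ltnP k N.
    rewrite -[k in LHS]/(val (Ordinal ltk)) shape_ofE ffunE inordK //=.
    have [lts|ge] := ltnP k (size la); last by rewrite nth_default.
    by have := bd _ lts; lia.
  rewrite shape_of_geq // nth_default //; apply: leq_trans gek.
  by rewrite -sla size_le_sumn // (andP pla).2.
have shp_inj (la : seq nat) : la \in parts N -> shp la = shp la0 -> la = la0.
  move=> laP e; case: (partsP laP) (partsP la0P) => pla _ [pla0 _].
  by apply: eq_part => // k; rewrite -!shpE // e.
have is_shapeP (la : seq nat) : la \in parts N -> is_shape N (nth 0 la).
  move=> laP; case: (partsP laP) => /andP [srt _] _.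
  by split; [case: (is_shape_nth srt) | rewrite -shpE // shape_of_geq].
(* Coefficients are kept only inside the fat hook; the terms outside it vanish at the virtual
   alphabet. *)
pose c' f : algC := (if hook p q f
  then \sum_(la <- parts N | shp la == f) (c la)%:~R else 0)%R.
have /(_ (shp la0)) : forall f, c' f = 0%R.
  apply: (@jacobi_trudi_indep algC N N p q) => [f /negPf nf|[x z]].
    by rewrite /c' nf.
  have [u eqp] := exists_power_sums x z p q N.
  have := congr1 (mmap intr (fun i : 'I_N => u i)) plE.
  rewrite (plethysm_eval0 N_gt0 pmu mu0 pnu ltq eqp) => E.
  apply: etrans (esym E); rewrite rmorph_sum /=.
  transitivity (\sum_(f : {ffun 'I_N -> 'I_N.+1})
     \sum_(la <- parts N | shp la == f)
       (c la)%:~R * jacobi_trudi N (nth 0%N la) (hsuper x z p q))%R.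
    apply: eq_bigr => f _; rewrite /c'; case: ifP => hf.
      rewrite big_distrl /= [LHS]big_seq_cond [RHS]big_seq_cond.
      apply: eq_bigr => la /andP [laP /eqP ef]; congr (_ * _)%R.
      by apply: eq_jacobi_trudi => [i _|i j _ _]; rewrite -ef shpE.
    rewrite mul0r big_seq_cond big1 // => la /andP [laP /eqP ef].
    have shl := is_shapeP _ laP.
    have ltq' : q < nth 0 la p.
      rewrite ltnNge; apply/negP => le; move/negP: hf; apply.
      by apply: is_shape_hook; rewrite -ef; [split=> [i|]; rewrite !shpE // ?(proj1 shl) ?(proj2 shl) | rewrite shpE].
    rewrite jacobi_trudi_hsuper0 ?mulr0 //.
    by rewrite ltnNge; apply: contraTN ltq' => ge; rewrite (is_shape_geq shl).
  rewrite (exchange_big_dep xpredT) //= big_seq [RHS]big_seq.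
  apply: eq_bigr => la laP.
  rewrite (big_pred1 (shp la)) => [|f]; last by rewrite eq_sym.
  rewrite mmapZ; congr (_ * _)%R; case: (partsP laP) => pla sla.
  rewrite /schur rmorph_schur_eval.
  rewrite (@eq_schur_eval _ _ _ _ (fun i : 'I_N => u i)); last first.
    by move=> i; rewrite /= mmapX mmap1U.
  rewrite (schur_eval_super N_gt0 pla (x := x) (z := z) (p := p) (q := q)) ?sla //.
  (* Padding by empty rows makes all determinants of size [N], as the independence statement
     requires. *)
  apply: jacobi_trudi_extend.
  - exact: (proj1 (newton_hsuper x z p q)).
  - by rewrite -sla size_le_sumn // (andP pla).2.
  - by move=> k; exact: nth_default.
rewrite /c'; have -> : hook p q (shp la0).
  have [anti la0N] := is_shapeP _ la0P.
  by apply: is_shape_hook; [split=> [i|]; rewrite !shpE | rewrite shpE].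
rewrite big_seq_cond (eq_bigr (fun=> (c la0)%:~R%R)); last first.
  by move=> la /andP [laP /eqP /(shp_inj _ laP) ->].
(* What remains is [c la0] times the multiplicity of [la0] in the list, which is positive. *)
rewrite -big_seq_cond big_const_seq iter_addr_0 => /eqP.
rewrite mulrn_eq0 intr_eq0 (negPf nz) orbF eqn0Ngt -has_count => /hasP; apply.
by exists la0.
Qed.
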